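(* Let $\mathrm{Peak}_{\mathcal A(0)}(t)=1$ and, for $n\ge1$, $\mathrm{Peak}_{\mathcal A(n)}(t)=\sum_{\mathbf a\in\mathcal A(n)}t^{\mathrm{peak}(\mathbf a)}$, where $\mathcal A(n)$ is the set of Abelian area sequences of size $n$. Then $\mathrm{Peak}_{\mathcal A(1)}(t)=t$, $\mathrm{Peak}_{\mathcal A(2)}(t)=t+t^2$, and for $n\ge3$ $$\mathrm{Peak}_{\mathcal A(n)}(t)=2\,\mathrm{Peak}_{\mathcal A(n-1)}(t)+(t-1)\,\mathrm{Peak}_{\mathcal A(n-2)}(t).$$ Moreover, $\mathrm{Peak}_{\mathcal A(n)}(t)$ is real-rooted for every $n\ge0$, and $\{\mathrm{Peak}_{\mathcal A(n)}(t)\}_{n\ge0}$ is a generalized Sturm sequence.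
   Context: Write $[n]=\{1,\dots,n\}$. An area sequence of size $n$ is a sequence $\mathbf a=(a_1,\dots,a_n)$ of nonnegative integers with $a_i<i$ for all $i$ and $a_i\le a_{i-1}+1$ for all $i\ge 2$. Each area sequence $\mathbf a$ defines a graph $\Gamma_{\mathbf a}$ (a unit interval graph) on $[n]$ with edges $\{j,i\}$ for $1\le j<i\le n$ with $i-a_i\le j$. A peak-edge of $\Gamma_{\mathbf a}$ is either an isolated vertex or an edge $\{i,j\}$, $i<j$, such that neither $\{i,j+1\}$ nor $\{i-1,j\}$ is an edge (pairs not contained in $[n]$ are not edges); $\mathrm{peak}(\mathbf a)$ is the number of peak-edges. An area sequence $\mathbf a$ of size $n$ is Abelian if every vertex $i\ne 1,n$ of $\Gamma_{\mathbf a}$ is adjacent to at least one of the vertices $1$ and $n$. A real polynomial is real-rooted if all its zeros are real (constants are real-rooted). For real-rooted $f,g$ with positive leading coefficients and zeros (with multiplicity) $\cdots\le\lambda_2\le\lambda_1$ and $\cdots\le\delta_2\le\delta_1$ respectively, write $g\ll f$ if $\cdots\le\delta_2\le\lambda_2\le\delta_1\le\lambda_1$ (so the degrees differ by at most one, $\deg g\le\deg f$); by convention also $0\ll0$, $0\ll f$, $f\ll0$. A sequence $\{f_i\}_{i\ge0}$ of real-rooted polynomials with positive leading coefficients is a generalized Sturm sequence if $f_{i-1}\ll f_i$ for all $i\ge1$. *)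

(* Defs.v *)
From HB Require Import structures.
From mathcomp Require Import all_boot all_order all_algebra.
From mathcomp Require Import reals complex.

Set Implicit Arguments.
Unset Strict Implicit.
Unset Printing Implicit Defensive.

Import Order.TTheory GRing.Theory Num.Theory.

(* Indices are 0-based: i : 'I_n stands for the vertex i.+1 of {1, ..., n}.
   An area sequence has all its entries < n, so it is a finite function
   'I_n -> 'I_n; the requirement a_i < i becomes a i <= i after the shift. *)
Definition is_area (n : nat) (a : {ffun 'I_n -> 'I_n}) : bool :=
  [forall i : 'I_n, a i <= i] &&
  [forall i : 'I_n, forall j : 'I_n, (j == i.+1 :> nat) ==> (a j <= (a i).+1)].

(* i - a_i <= j, written without truncated subtraction. *)
Definition adj (n : nat) (a : {ffun 'I_n -> 'I_n}) : rel 'I_n :=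
  fun x y => ((x < y) && (y <= x + a y)) || ((y < x) && (x <= y + a x)).

Definition isolated (n : nat) (a : {ffun 'I_n -> 'I_n}) (x : 'I_n) : bool :=
  [forall y : 'I_n, ~~ adj a x y].

(* Quantifying over k : 'I_n makes pairs that leave the vertex set non-edges. *)
Definition proper_peak (n : nat) (a : {ffun 'I_n -> 'I_n}) (i j : 'I_n) : bool :=
  [&& i < j, adj a i j,
      [forall k : 'I_n, (k == j.+1 :> nat) ==> ~~ adj a i k]
    & [forall k : 'I_n, (k.+1 == i :> nat) ==> ~~ adj a k j]].

Definition peak (n : nat) (a : {ffun 'I_n -> 'I_n}) : nat :=
  #|[set x | isolated a x]| +
  #|[set e : 'I_n * 'I_n | proper_peak a e.1 e.2]|.

Definition is_end (n : nat) (x : 'I_n) : bool := (x == 0 :> nat) || (x.+1 == n).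

Definition abelian_area (n : nat) (a : {ffun 'I_n -> 'I_n}) : bool :=
  is_area a &&
  [forall x : 'I_n, ~~ is_end x ==> [exists y : 'I_n, is_end y && adj a x y]].

Local Open Scope ring_scope.

Definition Peak (R : realType) (n : nat) : {poly R} :=
  if n is 0 then 1
  else \sum_(a : {ffun 'I_n -> 'I_n} | abelian_area a) 'X^(peak a).

(* The first disjunct only matters for the zero polynomial. *)
Definition real_rooted (R : realType) (p : {poly R}) : Prop :=
  (size p <= 1)%N \/
  forall z : R[i], root (map_poly (real_complex R) p) z -> complex.Im z = 0.

(* s lists the real zeros of p <> 0 with multiplicity, largest first. *)
Definition zero_seq (R : realType) (p : {poly R}) (s : seq R) : Prop :=
  sorted (fun x y => y <= x) s /\ forall x : R, count_mem x s = mup x p.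

Definition std_real_rooted (R : realType) (p : {poly R}) : Prop :=
  real_rooted p /\ 0 < lead_coef p.

(* d_(i+1) = nth 0 d i and l_(i+1) = nth 0 l i in
   ... <= d_2 <= l_2 <= d_1 <= l_1. *)
Definition interlaced_zeros (R : realType) (d l : seq R) : Prop :=
  [/\ (size d <= size l <= (size d).+1)%N,
      forall i : nat, (i < size d)%N -> nth 0 d i <= nth 0 l i
    & forall i : nat, (i.+1 < size l)%N -> nth 0 l i.+1 <= nth 0 d i].

(* interlaces g f is the relation g << f. *)
Definition interlaces (R : realType) (g f : {poly R}) : Prop :=
  [/\ g = 0 \/ std_real_rooted g,
      f = 0 \/ std_real_rooted f
    & g <> 0 -> f <> 0 ->
      exists d l : seq R,
        [/\ zero_seq g d, zero_seq f l & interlaced_zeros d l]].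

Definition generalized_sturm (R : realType) (f : nat -> {poly R}) : Prop :=
  (forall i : nat, std_real_rooted (f i)) /\
  (forall i : nat, (1 <= i)%N -> interlaces (f i.-1) (f i)).

(* Main.v *)
Require Import Defs.
From HB Require Import structures.
From mathcomp Require Import all_boot all_order all_algebra.
From mathcomp Require Import zify ring lra.
From mathcomp Require Import reals complex trigo.

Import Order.TTheory GRing.Theory Num.Theory.

(* An area sequence is determined by the nondecreasing map c sending a vertex to
   its leftmost neighbour, and its number of peaks is the number of values of c.
   When it is Abelian, all (0-based, shifted) positive values of c lie strictly
   before all ascents of c, so recording values and ascents gives a bijection
   with the even subsets of an n-set, with peak = 1 + half the cardinality.
   Hence Peak_n = X * Q_n with Q_n = sum_k binom(n, 2k) X^k. Pascal's rule gives
   the recurrence, and Q_n(1 - 1/cos^2 t) cos^n t = cos (n t) shows that the zeros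
   of Q_n are -tan^2 ((2k+1) pi / 2n), whose interlacing is read off the angles. *)

(** * Counting the elements of a predicate below a bound *)

Definition cnt (P : pred nat) (n : nat) : nat := count P (iota 0 n).

Lemma cntS (P : pred nat) n : cnt P n.+1 = cnt P n + P n.
Proof. by rewrite /cnt -addn1 iotaD count_cat /= addn0. Qed.

Lemma leq_cnt (P : pred nat) i j : i <= j -> cnt P i <= cnt P j.
Proof. by move=> /subnK <-; elim: (j - i) => // k IH; rewrite addSn cntS; lia. Qed.

Lemma cnt_gap (P : pred nat) i j :
  i <= j -> (forall v, i <= v < j -> ~~ P v) -> cnt P j = cnt P i.
Proof.
move=> /subnK <-; elim: (j - i) => // k IH PN; rewrite addSn cntS.
rewrite IH => [|v v_in]; last by apply: PN; lia.
by rewrite (negbTE (PN _ _)) ?addn0 //; lia.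
Qed.

Lemma eq_cnt (P Q : pred nat) n :
  (forall v, v < n -> P v = Q v) -> cnt P n = cnt Q n.
Proof. by move=> PQ; apply: eq_in_count => v; rewrite mem_iota => /PQ. Qed.

(** A down-closed predicate holds on an initial segment, and the count is the length of that
    segment. *)
Lemma cnt_initial (Q : pred nat) n v :
  (forall i j, i <= j -> Q j -> Q i) -> v < n -> (v < cnt Q n) = Q v.
Proof.
move=> Qdown; have cntn k : cnt Q k <= k by rewrite (leq_trans (count_size _ _)) ?size_iota.
have cnt_id k : (forall i, i < k -> Q i) -> cnt Q k = k.
  elim: k => // k IH Qk; rewrite cntS IH => [|i ik]; first by rewrite (Qk k (ltnSn k)) addn1.
  by apply: Qk; lia.
move=> vn; case: (boolP (Q v)) => Qv.
  have: cnt Q v.+1 = v.+1 by apply: cnt_id => i iv; apply: Qdown Qv.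
  by have := leq_cnt Q _ _ vn; lia.
apply/negbTE; rewrite -leqNgt (@cnt_gap Q v n) ?cntn ?(ltnW vn) // => w /andP[vw _].
by apply: contra Qv; apply: Qdown.
Qed.

(** The count rises by at most one at each step, so every rank below the total is reached at an
    element of [P]. *)
Lemma cnt_reach (P : pred nat) n k :
  k < cnt P n -> exists2 x, x < n & P x && (cnt P x == k).
Proof.
elim: n => // n IH; rewrite cntS; case: (ltnP k (cnt P n)) => [/IH[x xn xP] _|kn].
  by exists x => //; lia.
by move=> kn1; exists n => //; move: kn kn1; case: (P n) => /=; lia.
Qed.

(* Below, c x is the leftmost neighbour of x (x itself if there is none to the
   left), with 0-based vertices; being Abelian reads: c x = 0 or c y <= x for
   all x and y. *)
Definition ascent (c : nat -> nat) (x : nat) : bool := (0 < x) && (c x.-1 < c x).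

(** The shift by one makes these indices disjoint from the ascents in the Abelian case, so that a
    single set can record both. *)
Definition attained (c : nat -> nat) (n v : nat) : bool :=
  has (fun y => c y == v.+1) (iota 0 n).

Lemma attainedP (c : nat -> nat) n v :
  reflect (exists2 y, y < n & c y = v.+1) (attained c n v).
Proof.
apply: (iffP hasP) => [[y]|[y yn cy]]; first by rewrite mem_iota => yn /eqP cy; exists y.
by exists y; rewrite ?mem_iota ?cy.
Qed.

Definition nondecr_on (n : nat) (c : nat -> nat) : Prop :=
  forall x y, x <= y -> y < n -> c x <= c y.

(* Each ascent up to x creates exactly one new positive value of c. *)
Lemma cnt_ascent (c : nat -> nat) n x :
    c 0 = 0 -> nondecr_on n c -> x < n ->
  cnt (ascent c) x.+1 = cnt (attained c n) (c x).
Proof.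
move=> c0 cM; elim: x => [|x IH] xn; first by rewrite c0.
rewrite cntS IH 1?ltnW // /ascent /=.
have := cM x x.+1 (leqnSn x) xn; rewrite leq_eqVlt => /predU1P[->|cx].
  by rewrite ltnn addn0.
rewrite cx; case E: (c x.+1) cx => [//|w] cx; rewrite cntS (@cnt_gap _ (c x) w) //; last first.
  move=> v v_in; apply/attainedP => -[y yn cy].
  have [yx|xy] := leqP y x; first by have := cM y x yx (ltnW xn); lia.
  by have := cM x.+1 y xy yn; lia.
by congr (_ + nat_of_bool _); symmetry; apply/attainedP; exists x.+1.
Qed.

(** * From leftmost neighbours to even sets *)

Section FromColumns.

Variables (c : nat -> nat) (n : nat).
Hypotheses (n_gt0 : 0 < n) (c0 : c 0 = 0) (cM : nondecr_on n c).
Hypothesis c_abelian : forall x y, x < n -> y < n -> c x = 0 \/ c y <= x.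

Lemma ascent_attainedF v : v < n -> ascent c v -> attained c n v -> False.
Proof.
move=> vn /andP[_ cv] /attainedP[y yn cy].
by case: (c_abelian v y vn yn); lia.
Qed.

(** The last vertex has the largest value of [c], so [cnt_ascent] there already sees every attained
    value. *)
Lemma cnt_attained_all : cnt (attained c n) n = cnt (ascent c) n.
Proof.
have n1 : n.-1 < n by lia.
have cn : c n.-1 <= n by case: (c_abelian n.-1 n.-1 n1 n1); lia.
rewrite -[in RHS](prednK n_gt0) (@cnt_ascent c n) // (@cnt_gap _ (c n.-1) n) // => v v_in.
by apply/attainedP => -[y yn cy]; have := cM y n.-1; lia.
Qed.

Variable P : pred nat.
Hypothesis P_def : forall v, v < n -> P v = ascent c v || attained c n v.

Lemma cnt_split v : v <= n -> cnt P v = cnt (ascent c) v + cnt (attained c n) v.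
Proof.
elim: v => // v IH vn; rewrite !cntS IH 1?ltnW // P_def //.
have := ascent_attainedF v vn.
by case: (ascent c v); case: (attained c n v) => //= H; lia.
Qed.

Lemma cnt_all : cnt P n = (cnt (ascent c) n).*2.
Proof. by rewrite cnt_split // cnt_attained_all addnn. Qed.

(** This recovers [c] from [P]. If [c x > 0], every attained index lies below [x], so [cnt P x.+1]
    is half of the total plus [cnt (attained c n) (c x)]. For [v < c x] no ascent lies below [v],
    hence [cnt P v] counts attained indices only. If [c x = 0], there is no ascent up to [x], and
    both sides are false. *)
Lemma column_ltn v x : v < n -> x < n ->
  (v < c x) = (cnt P v + (cnt P n)./2 < cnt P x.+1).
Proof.
move=> vn xn; rewrite cnt_all doubleK -cnt_attained_all !cnt_split ?(ltnW vn) //.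
rewrite (@cnt_ascent c n) //; have [cx0|cx] := posnP (c x).
  by rewrite cx0 ltn0 add0n; have := leq_cnt (attained c n) _ _ xn; lia.
have attN w : x <= w < n -> ~~ attained c n w.
  by move=> w_in; apply/attainedP => -[y yn cy]; case: (c_abelian x y xn yn); lia.
have -> : cnt (attained c n) x.+1 = cnt (attained c n) n.
  by rewrite (@cnt_gap _ x n) 1?(ltnW xn) // (@cnt_gap _ x x.+1) // => w w_in; apply: attN; lia.
have [cxv|vcx] := leqP (c x) v; first by have := leq_cnt (attained c n) _ _ cxv; lia.
rewrite (@cnt_gap (ascent c) 0 v) // => [|w w_in]; last first.
  rewrite /ascent; apply/negP => /andP[_ cw].
  by case: (c_abelian w x _ xn); lia.
have attc : attained c n (c x).-1 by apply/attainedP; exists x; lia.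
have := cntS (attained c n) (c x).-1; rewrite attc prednK //.
have : v <= (c x).-1 by lia.
by move/(leq_cnt (attained c n)); rewrite (erefl : cnt _ 0 = 0); lia.
Qed.

End FromColumns.

(* column inverts the passage from c to the set P of its ascents and of the v
   with v.+1 attained: the first half of P lists the attained values (shifted
   by one) and the second half the ascents. *)
Definition column (P : pred nat) (n x : nat) : nat :=
  cnt (fun v => cnt P v + (cnt P n)./2 < cnt P x.+1) n.

Lemma ltn_column (P : pred nat) n v x : v < n ->
  (v < column P n x) = (cnt P v + (cnt P n)./2 < cnt P x.+1).
Proof.
move=> vn; rewrite /column cnt_initial // => i j ij.
by have := leq_cnt P _ _ ij; lia.
Qed.

(** * From even sets to leftmost neighbours *)

Section ToColumns.

Variables (P : pred nat) (n : nat).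
Hypothesis even_P : ~~ odd (cnt P n).
Let c := column P n.
Let d := (cnt P n)./2.

Let cntP : cnt P n = d + d. Proof. by rewrite addnn halfK (negbTE even_P) subn0. Qed.

Let ltc v x (vn : v < n) : (v < c x) = (cnt P v + d < cnt P x.+1).
Proof. exact: ltn_column. Qed.

Lemma column_le_size x : c x <= n.
Proof. by rewrite (leq_trans (count_size _ _)) ?size_iota. Qed.

Lemma column_nondecr : nondecr_on n c.
Proof.
move=> x y xy yn; rewrite leqNgt; apply/negP => cyx.
have cyn : c y < n by apply: leq_trans cyx (column_le_size x).
move: (cyx); rewrite ltc // => cx.
have := ltnn (c y); rewrite ltc //.
by have := leq_cnt P x.+1 y.+1 xy; lia.
Qed.

Lemma column_le x : x < n -> c x <= x.
Proof.
move=> xn; rewrite leqNgt ltc // cntS -leqNgt.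
(* Evenness enters here: if [x] is in [P], then [P] has at least two elements and [d >= 1]. *)
by have := leq_cnt P _ _ xn; rewrite cntS; case: (P x) => /=; lia.
Qed.

(** If [0 < c x], at least [d] elements of [P] lie below [x]; since there are only [2d] in all, the
    threshold at [x] can never be exceeded. *)
Lemma column_abelian x y : x < n -> y < n -> c x = 0 \/ c y <= x.
Proof.
move=> xn yn; have n0 : 0 < n by lia.
have [->|cx] := posnP (c x); [by left|right].
move: cx; rewrite ltc // cntS => cx; rewrite leqNgt ltc // -leqNgt.
by have := leq_cnt P _ _ yn; rewrite cntP; have : cnt P 0 = 0 by []; lia.
Qed.

(** The element of rank [r < d] is matched with the one of rank [r + d]: the smaller gives an
    attained value, the larger an ascent. *)
Lemma column_recover v : v < n -> ascent c v || attained c n v = P v.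
Proof.
move=> vn; apply/idP/idP.
  case/orP => [/andP[v0 cv]|/attainedP[x xn cx]].
    have cn : c v.-1 < n by have := column_le v.-1; lia.
    have := ltnn (c v.-1); rewrite ltc // prednK //.
    move: cv; rewrite ltc // cntS.
    by case: (P v) => //=; lia.
  have vn1 : v.+1 < n by have := column_le x xn; lia.
  have : v < c x by rewrite cx.
  have := ltnn (c x); rewrite {1}cx !ltc // cntS.
  by case: (P v) => //=; lia.
move=> Pv; have PvS : cnt P v.+1 = (cnt P v).+1 by rewrite cntS Pv addn1.
have [vd|dv] := ltnP (cnt P v) d; apply/orP; [right|left].
  (* This [x] is the partner of [v] in the second half of [P], and [c x = v.+1]. *)
  have [|x xn /andP[Px /eqP xv]] := cnt_reach P n (cnt P v + d); first lia.
  apply/attainedP; exists x => //; apply/eqP; rewrite eqn_leq.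
  rewrite ltc // cntS Px xv; apply/andP; split; last by lia.
  have [vn1|vn1] := ltnP v.+1 n; last by have := column_le x xn; lia.
  by rewrite leqNgt ltc // (cntS P x) Px xv PvS; lia.
have v0 : 0 < v.
  have := leq_cnt P _ _ vn; rewrite PvS; case: (v) dv PvS => // + PvS.
  by rewrite (erefl : cnt P 0 = 0); lia.
(* This [w] is the partner of [v] in the first half of [P]; it witnesses the ascent through
   [c v.-1 <= w < c v]. *)
have [|w wn /andP[Pw /eqP wv]] := cnt_reach P n (cnt P v - d).
  by have := leq_cnt P _ _ vn; lia.
rewrite /ascent v0 /=; apply: (@leq_ltn_trans w).
  by rewrite leqNgt ltc // prednK // wv; lia.
by rewrite ltc // PvS wv; lia.
Qed.

End ToColumns.

Lemma card_cnt (P : pred nat) n : #|[set x : 'I_n | P x]| = cnt P n.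
Proof.
rewrite -sum1_card /cnt -sum1_count.
have -> : iota 0 n = index_iota 0 n by rewrite /index_iota subn0.
by rewrite big_mkord; apply: eq_bigl => x; rewrite inE.
Qed.

(** * Area sequences and their graphs in terms of leftmost neighbours *)

Section Bijection.

Variable m : nat.
Notation n := m.+1.
Implicit Types (a : {ffun 'I_n -> 'I_n}) (T : {set 'I_n}).

Definition left_nbr a (x : nat) : nat := x - a (inord x).

Lemma left_nbrE a (x : 'I_n) : left_nbr a x = x - a x.
Proof. by rewrite /left_nbr inord_val. Qed.

(** The condition on consecutive entries rearranges to [x - a x <= x.+1 - a x.+1]. *)
Lemma is_areaP a :
  reflect [/\ forall x : 'I_n, a x <= x & nondecr_on n (left_nbr a)] (is_area a).
Proof.
apply: (iffP andP) => [[/forallP a_le aS]|[a_le cM]].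
  split=> // x y xy; rewrite -(subnK xy); elim: (y - x) => // k IH kn.
  apply: leq_trans (IH (ltnW kn)) _; rewrite addSn /left_nbr.
  have := forallP aS (inord (k + x)) => /forallP/(_ (inord (k + x).+1)).
  have kn' : k + x < n by exact: ltnW.
  by have := a_le (inord (k + x)); rewrite !inordK // eqxx /=; lia.
split; apply/forallP => // x; apply/forallP => y; apply/implyP => /eqP yx.
have := cM x y; rewrite yx leqnSn -[x.+1]yx !left_nbrE.
by have := a_le x; have := a_le y; have := ltn_ord y; lia.
Qed.

Section Area.

Variable a : {ffun 'I_n -> 'I_n}.
Hypothesis a_area : is_area a.
Let c := left_nbr a.

Let a_le (x : 'I_n) : a x <= x. Proof. by case/is_areaP: a_area. Qed.
Let cM : nondecr_on n c. Proof. by case/is_areaP: a_area. Qed.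

Lemma adjE (x y : 'I_n) : adj a x y = (x < y) && (c y <= x) || (y < x) && (c x <= y).
Proof. by rewrite /adj /c !left_nbrE; have := a_le x; have := a_le y; lia. Qed.

(** [c x = x] excludes left neighbours. By monotonicity, any right neighbour would make [x.+1] one
    as well, which an ascent at [x.+1] excludes. *)
Lemma isolatedE (x : 'I_n) :
  isolated a x = ((x.+1 == n) || ascent c x.+1) && (c x == x).
Proof.
have cx : c x <= x by rewrite /c left_nbrE leq_subr.
apply/forallP/andP => [Nadj|[xE /eqP cxx] y]; last first.
  rewrite adjE cxx; case: (ltngtP x y) => //= xy.
  have xn : x.+1 < n by have := ltn_ord y; lia.
  rewrite orbF -ltnNge (leq_trans _ (cM x.+1 y _ _)) //.
  by move: xE; rewrite (ltn_eqF xn) /ascent /= cxx.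
have cxx : c x = x.
  apply/eqP; rewrite eqn_leq cx leqNgt; apply/negP => cx_lt.
  have := Nadj (inord (c x)); rewrite adjE inordK; last by have := ltn_ord x; lia.
  by rewrite cx_lt leqnn orbT.
split; last exact/eqP.
have := ltn_ord x; rewrite ltnS leq_eqVlt eqSS => /predU1P[->|xm]; first by rewrite eqxx.
have := Nadj (inord x.+1); rewrite adjE inordK // ltnSn /ascent /= cxx; lia.
Qed.

(** The missing edge on the left forces [x] to be the leftmost neighbour of [y]; the one on the
    right then says that [c] increases just after [y]. So [y] determines the peak-edge. *)
Lemma proper_peakE (x y : 'I_n) :
  proper_peak a x y =
    [&& (y.+1 == n) || ascent c y.+1, c y < y & x == c y :> nat].
Proof.
have cy : c y <= y by rewrite /c left_nbrE leq_subr.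
apply/and4P/and3P => [[xy]|[yE cy_lt /eqP xc]].
  rewrite adjE xy (ltnNge y x) (ltnW xy) orbF /= => cyx /forallP Nr /forallP Nl.
  have xc : x = c y :> nat.
    apply/eqP; rewrite eqn_leq cyx andbT leqNgt; apply/negP => cy_lt.
    have xn := ltn_ord x; have := Nl (inord x.-1); rewrite adjE inordK; last by lia.
    by lia.
  split; [|by rewrite -xc|exact/eqP].
  have := ltn_ord y; rewrite ltnS leq_eqVlt eqSS => /predU1P[->|ym]; first by rewrite eqxx.
  have := Nr (inord y.+1); rewrite adjE inordK // eqxx /ascent /= -xc; lia.
split; first by rewrite xc.
- by rewrite adjE xc cy_lt leqnn.
- apply/forallP => z; apply/implyP => /eqP zy; rewrite adjE zy.
  move: yE; have zn := ltn_ord z; rewrite zy in zn; rewrite (ltn_eqF zn) /ascent /=.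
  by lia.
- by apply/forallP => z; apply/implyP => /eqP zx; rewrite adjE; lia.
Qed.

(* The right ends of peak-edges and the isolated vertices are together exactly
   the last vertices of the level sets of c. *)
Lemma peakE : peak a = (cnt (ascent c) n).+1.
Proof.
pose E x := (x.+1 == n) || ascent c x.+1.
have Ecnt k : k <= m -> cnt E k = cnt (ascent c) k.+1.
  elim: k => // k IH km; rewrite cntS IH 1?ltnW // [in RHS]cntS /E.
  by rewrite (ltn_eqF (_ : k.+1 < n)).
have <- : cnt E n = (cnt (ascent c) n).+1.
  (* The extra one is the last vertex, which closes the top level set without a following ascent. *)
  by rewrite cntS Ecnt // /E eqxx addn1.
pose F x := E x && (c x == x); pose G x := E x && (c x < x).
have -> : cnt E n = cnt F n + cnt G n.
  rewrite -!card_cnt -cardsUI; set I := _ :&: _; suff -> : I = set0.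
    rewrite cards0 addn0; apply: eq_card => x; rewrite !inE /F /G -andb_orr -leq_eqVlt.
    by rewrite (_ : c x <= x) ?andbT // /c left_nbrE leq_subr.
  by apply/setP => x; rewrite !inE /F /G; case: ltngtP; rewrite ?andbF.
rewrite /peak; congr (_ + _).
  by rewrite -card_cnt; apply: eq_card => x; rewrite !inE isolatedE.
pose e (x : 'I_n) : 'I_n * 'I_n := (inord (c x), x).
have e_inj : injective e by move=> x y [].
rewrite -card_cnt -(card_imset _ e_inj); apply: eq_card => -[x y]; rewrite inE proper_peakE.
apply/and3P/imsetP => [[yE cy /eqP xc]|[z + [-> ->]]].
  by exists y; [rewrite inE /G /E yE|rewrite /e -xc inord_val].
rewrite inE => /andP[zE cz]; split=> //; rewrite inordK //.
by apply: ltn_trans cz (ltn_ord z).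
Qed.

(** An inner vertex [x] is adjacent to the first vertex iff [c x = 0], and to the last vertex [m]
    iff [c m <= x], where [c m] is the maximum of [c]. The two end vertices satisfy the condition
    automatically. *)
Lemma abelianP :
  reflect (forall x y, x < n -> y < n -> c x = 0 \/ c y <= x) (abelian_area a).
Proof.
have c_le x : c x <= x by apply: leq_subr.
rewrite /abelian_area a_area; apply: (iffP forallP) => [ab x y xn yn|ab x].
  suff: c x = 0 \/ c m <= x.
    by case=> [|cm]; [left|right; apply: leq_trans (cM y m _ _) cm].
  have := ab (inord x); rewrite /is_end inordK //.
  case: posnP => [->|x0] /=; first by left.
  rewrite eqSS; case: eqP => [->|/eqP xm] /=; first by right.
  case/existsP => y'; rewrite adjE inordK //.
  by case/andP => /orP[]/eqP y'E; have := ltn_ord y'; rewrite ?y'E;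
     [left|case: y'E => ->; right]; lia.
apply/implyP; rewrite negb_or => /andP[x0 xm].
have xm' : x < m by have := ltn_ord x; lia.
apply/existsP; case: (ab x m) => // [cx|cm].
  by exists ord0; rewrite adjE /is_end /=; lia.
by exists ord_max; rewrite adjE /is_end /=; lia.
Qed.

End Area.

(** * The bijection with even subsets *)

Definition memn T (v : nat) : bool := inord v \in T.

Lemma cnt_memn T : cnt (memn T) n = #|T|.
Proof. by rewrite -card_cnt; apply: eq_card => x; rewrite inE /memn inord_val. Qed.

Definition set_of_area a : {set 'I_n} :=
  [set x : 'I_n | ascent (left_nbr a) x || attained (left_nbr a) n x].

Definition area_of_set T : {ffun 'I_n -> 'I_n} :=
  [ffun x : 'I_n => inord (x - column (memn T) n x)].

Lemma memn_set_of_area a v : v < n ->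
  memn (set_of_area a) v = ascent (left_nbr a) v || attained (left_nbr a) n v.
Proof. by move=> vn; rewrite /memn inE inordK. Qed.

Lemma left_nbr_area_of_set T x : ~~ odd #|T| -> x < n ->
  left_nbr (area_of_set T) x = column (memn T) n x.
Proof.
rewrite -cnt_memn => T_even xn; rewrite /left_nbr ffunE !inordK //.
  by rewrite subKn // column_le.
by apply: leq_ltn_trans (leq_subr _ _) xn.
Qed.

Lemma abelian_area_of_set T : ~~ odd #|T| -> abelian_area (area_of_set T).
Proof.
move=> T_even; have T_even' := T_even; rewrite -cnt_memn in T_even'.
have ar : is_area (area_of_set T).
  apply/is_areaP; split=> [x|x y xy yn].
    rewrite ffunE inordK ?leq_subr //.
    by apply: leq_ltn_trans (leq_subr _ _) (ltn_ord x).
  rewrite !left_nbr_area_of_set ?(leq_ltn_trans xy yn) //.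
  exact: column_nondecr.
apply/(abelianP _ ar) => x y xn yn; rewrite !left_nbr_area_of_set //.
exact: column_abelian.
Qed.

Lemma eq_on_attained (c c' : nat -> nat) v : (forall x, x < n -> c x = c' x) ->
  v < n -> ascent c v || attained c n v = ascent c' v || attained c' n v.
Proof.
move=> cc' vn; congr (_ || _).
  by rewrite /ascent !cc' // (leq_ltn_trans (leq_pred v)).
by apply: eq_in_has => y; rewrite mem_iota => yn; rewrite cc'.
Qed.

Lemma area_of_setK T : ~~ odd #|T| -> set_of_area (area_of_set T) = T.
Proof.
move=> T_even; apply/setP => x; rewrite inE.
rewrite (@eq_on_attained _ (column (memn T) n)) // => [|y yn].
  by rewrite column_recover ?cnt_memn // /memn inord_val.
exact: left_nbr_area_of_set.
Qed.

Lemma set_of_areaK a : abelian_area a -> area_of_set (set_of_area a) = a.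
Proof.
move=> ab; have ar : is_area a by case/andP: ab.
have [a_le cM] := is_areaP _ ar.
apply/ffunP => x; rewrite ffunE.
suff -> : column (memn (set_of_area a)) n x = left_nbr a x.
  by rewrite left_nbrE subKn ?a_le // inord_val.
have left_nbr_le : left_nbr a x <= n by rewrite left_nbrE; have := ltn_ord x; lia.
have memE v vn := memn_set_of_area a v vn.
(* By [column_ltn], the threshold condition defining [column] selects exactly the [v] below
   [left_nbr a x]. *)
rewrite /column (eq_cnt _ (fun v => v < left_nbr a x)) => [|v vn]; last first.
  symmetry; apply: (column_ltn (left_nbr a) n _ _ _ _ _ memE) => //; exact/(abelianP _ ar).
rewrite (@cnt_gap _ (left_nbr a x) n left_nbr_le) => [|v]; last by lia.
by rewrite (eq_cnt _ predT) // /cnt count_predT size_iota.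
Qed.

Lemma card_set_of_area a : abelian_area a -> #|set_of_area a| = (peak a).-1.*2.
Proof.
move=> ab; have ar : is_area a by case/andP: ab.
have [a_le cM] := is_areaP _ ar.
rewrite -cnt_memn (@cnt_all (left_nbr a)) ?peakE //.
- exact/(abelianP _ ar).
- exact: memn_set_of_area.
Qed.

Local Open Scope ring_scope.

Lemma PeakS (R : realType) :
  Peak R n = \sum_(T : {set 'I_n} | ~~ odd #|T|) 'X^(#|T|./2.+1).
Proof.
rewrite /Peak (reindex_onto area_of_set set_of_area set_of_areaK).
apply: eq_big => [T|T /andP[ab /eqP TK]].
  apply/andP/idP => [[ab /eqP <-]|T_even]; first by rewrite card_set_of_area // odd_double.
  by rewrite abelian_area_of_set // area_of_setK.
rewrite -[in RHS]TK card_set_of_area // doubleK prednK //.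
by rewrite peakE //; case/andP: ab.
Qed.

End Bijection.

Local Open Scope ring_scope.

(** * The even binomial polynomials and their recurrence *)

Section Polynomials.

Variable R : realType.
Implicit Types (n k : nat) (x y : R).

(** This is ((1 + s)^n + (1 - s)^n) / 2 with s^2 = X. The numbers 1 + s and 1 - s are the roots of
    y^2 = 2 y + (X - 1), which explains the shape of the recurrence. *)
Definition even_binomial n : {poly R} := \poly_(k < n./2.+1) 'C(n, k.*2)%:R.

Lemma coef_even_binomial n k : (even_binomial n)`_k = 'C(n, k.*2)%:R.
Proof. by rewrite coef_poly; case: ltnP => // kn; rewrite bin_small //; lia. Qed.

Lemma Peak_even_binomial n : (0 < n)%N -> Peak R n = 'X * even_binomial n.
Proof.
case: n => // m _; rewrite PeakS; apply/polyP => i; rewrite coef_sum coefXM.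
under eq_bigr do rewrite coefXn.
case: i => [|k] /=; first by rewrite big1.
rewrite coef_even_binomial -natr_sum; congr _%:R.
have -> : 'C(m.+1, k.*2) = #|[set T : {set 'I_m.+1} | #|T| == k.*2]|.
  by rewrite card_draws card_ord.
rewrite -sum1_card big_mkcond [RHS]big_mkcond /=.
apply: eq_bigr => T _; rewrite inE eqSS; case: ifP => T_even.
  suff -> : (#|T| == k.*2) = (k == #|T|./2) by case: eqP.
  by lia.
by case: ifP => // /eqP Tk; rewrite Tk odd_double in T_even.
Qed.

Lemma even_binomialSS n :
  even_binomial n.+2 = 2%:R *: even_binomial n.+1 + ('X - 1) * even_binomial n.
Proof.
apply/polyP => k; rewrite coefD coefZ mulrBl mul1r coefB coefXM !coef_even_binomial.
case: k => [|k] /=; first by rewrite !bin0; ring.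
rewrite doubleS !binS !natrD; ring.
Qed.

Lemma size_even_binomial n : size (even_binomial n) = n./2.+1.
Proof. by rewrite size_poly_eq // pnatr_eq0 -lt0n bin_gt0; lia. Qed.

(* cos (n t) is a Chebyshev polynomial in cos t, and even_binomial obeys the
   Chebyshev recurrence after the substitution X = 1 - 1 / cos^2 t. *)
Lemma even_binomial_cos n (t : R) : cos t != 0 ->
  (even_binomial n).[1 - (cos t) ^- 2] * cos t ^+ n = cos (n%:R * t).
Proof.
move=> ct; have [] : (even_binomial n).[1 - (cos t) ^- 2] * cos t ^+ n = cos (n%:R * t) /\
  (even_binomial n.+1).[1 - (cos t) ^- 2] * cos t ^+ n.+1 = cos (n.+1%:R * t); last by [].
elim: n => [|n [IH IH1]].
  rewrite /even_binomial !poly_def !big_ord1 /= !bin0 !scale1r expr0 !hornerE.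
  by rewrite cos0 expr1.
split=> //; rewrite even_binomialSS.
rewrite hornerD hornerZ hornerM hornerD hornerX hornerN hornerC.
have -> : cos (n.+2%:R * t) = cos (n.+1%:R * t) * cos t *+ 2 - cos (n%:R * t).
  have -> : n.+2%:R * t = n.+1%:R * t + t by rewrite -addn1 natrD mulrDl mul1r.
  have -> : n%:R * t = n.+1%:R * t - t by rewrite -addn1 natrD mulrDl mul1r addrK.
  by rewrite cosD cosB; ring.
rewrite -IH1 -IH (exprS _ n.+1) (exprS _ n).
have step (p q c d : R) : c != 0 ->
  (2%:R * p + (1 - c ^- 2 - 1) * q) * (c * (c * d)) = p * (c * d) * c *+ 2 - q * d.
  by move=> c0; field.
exact: step.
Qed.

(** * Trigonometric zeros and their interlacing *)

Lemma cos_odd_pihalf k : cos (k.*2.+1%:R * (pi / 2)) = 0 :> R.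
Proof.
elim: k => [|k IH]; first by rewrite mul1r cos_pihalf.
have -> : k.+1.*2.+1%:R * (pi / 2) = k.*2.+1%:R * (pi / 2) + pi :> R.
  by rewrite doubleS -addn2 natrD; field.
by rewrite cosDpi IH oppr0.
Qed.

(** For [k < n./2] these are the zeros of cos (n t) strictly between 0 and pi / 2. *)
Definition angle n k : R := k.*2.+1%:R / n%:R * (pi / 2).

Definition binomial_zero n k : R := 1 - (cos (angle n k)) ^- 2.

Lemma angle_bounds n k : (k < n./2)%N -> 0 < angle n k < pi / 2.
Proof.
move=> kn; have n0 : 0 < n%:R :> R by rewrite ltr0n; lia.
have pi2 : 0 < pi / 2 :> R by rewrite divr_gt0 ?pi_gt0.
rewrite /angle mulr_gt0 ?[0 < _ / n%:R]divr_gt0 ?ltr0Sn //=.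
by rewrite gtr_pMl // ltr_pdivrMr // mul1r ltr_nat; lia.
Qed.

Lemma angle_cos_gt0 n k : (k < n./2)%N -> 0 < cos (angle n k).
Proof. by move/angle_bounds => ?; apply: cos_gt0_pihalf; lra. Qed.

(** The map t -> 1 - 1 / cos^2 t is strictly decreasing on (0, pi / 2), so zeros compare oppositely
    to their angles; cross-multiplying leaves integers. *)
Lemma ltr_zero n k n' k' : (k < n./2)%N -> (k' < n'./2)%N ->
  (binomial_zero n k < binomial_zero n' k') = (k'.*2.+1 * n < k.*2.+1 * n')%N.
Proof.
move=> kn kn'; have [b b'] := (angle_bounds _ _ kn, angle_bounds _ _ kn').
rewrite /binomial_zero ltrD2l ltrN2 ltf_pV2 ?posrE ?exprn_gt0 ?angle_cos_gt0 //.
rewrite ltr_pXn2r ?nnegrE ?ltW ?angle_cos_gt0 // ltr_cos ?in_itv /=; try lra.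
rewrite /angle ltr_pM2r ?divr_gt0 ?pi_gt0 // ltr_pdivrMr ?ltr0n; last by lia.
rewrite mulrAC ltr_pdivlMr ?ltr0n; last by lia.
by rewrite -!natrM ltr_nat.
Qed.

Lemma binomial_zero_lt0 n k : (k < n./2)%N -> binomial_zero n k < 0.
Proof.
move=> kn; have b := angle_bounds _ _ kn; have c0 := angle_cos_gt0 _ _ kn.
have c1 : cos (angle n k) < 1 by rewrite -cos0 ltr_cos ?in_itv /=; lra.
by rewrite subr_lt0 invf_gt1 ?exprn_gt0 // exprn_ilt1 ?ltW.
Qed.

Lemma root_binomial_zero n k : (k < n./2)%N -> root (even_binomial n) (binomial_zero n k).
Proof.
move=> kn; have c0 := angle_cos_gt0 _ _ kn.
have := even_binomial_cos n (angle n k) (lt0r_neq0 c0).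
have -> : n%:R * angle n k = k.*2.+1%:R * (pi / 2).
  by rewrite /angle; field; rewrite pnatr_eq0; lia.
rewrite cos_odd_pihalf => /eqP; rewrite mulf_eq0 expf_eq0 (gt_eqF c0) andbF orbF.
by [].
Qed.

Definition Peak_zeros n : seq R :=
  if n is 0 then [::] else 0 :: mkseq (binomial_zero n) n./2.

Lemma size_Peak_zeros n : (0 < n)%N -> size (Peak_zeros n) = n./2.+1.
Proof. by case: n => // n _; rewrite /= size_map size_iota. Qed.

Lemma nth_Peak_zeros n k : (k < n./2)%N -> nth 0 (Peak_zeros n) k.+1 = binomial_zero n k.
Proof. by case: n => // n kn; rewrite /= nth_mkseq. Qed.

Lemma Peak_zeros_sorted n : sorted (fun x y => y < x) (Peak_zeros n).
Proof.
apply/(sortedP 0) => i; case: n => // n; rewrite size_Peak_zeros // ltnS => i_n.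
rewrite nth_Peak_zeros //; case: i i_n => [|i] i_n; first exact: binomial_zero_lt0.
by rewrite nth_Peak_zeros ?(ltnW i_n) // ltr_zero ?(ltnW i_n) // ltn_mul2r; lia.
Qed.

Lemma Peak_factor n :
  exists2 c : R, 0 < c & Peak R n = c *: \prod_(z <- Peak_zeros n) ('X - z%:P).
Proof.
case: n => [|n]; first by exists 1; rewrite // big_nil scale1r.
have sz := size_even_binomial n.+1.
exists (lead_coef (even_binomial n.+1)).
  by rewrite lead_coefE sz coef_even_binomial ltr0n bin_gt0 /=; lia.
rewrite big_cons subr0 Peak_even_binomial // scalerAr; congr (_ * _).
apply: all_roots_prod_XsubC; first by rewrite sz size_map size_iota.
  by apply/allP => _ /mapP[k + ->]; rewrite mem_iota => kn; apply: root_binomial_zero.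
(* The roots found are as many as the degree; their distinctness comes from the strict ordering of
   [Peak_zeros]. *)
rewrite uniq_rootsE; apply: (@subseq_uniq _ _ (Peak_zeros n.+1)); first exact: subseq_cons.
by apply: sorted_uniq (Peak_zeros_sorted _); [move=> ? ? ? /[swap]; exact: lt_trans|move=> ?; exact: ltxx].
Qed.

(** For N >= 1, the zeros of indices N and N + 1 interlace because (2k+1)/(N+1) <= (2k+1)/N <=
    (2k+3)/(N+1); the second inequality amounts to 2k+1 <= 2N. The common zero 0 heads both
    lists. *)
Lemma Peak_zeros_interlaced n : interlaced_zeros (Peak_zeros n) (Peak_zeros n.+1).
Proof.
case: n => [|n]; first by split.
rewrite /interlaced_zeros !size_Peak_zeros //; split; first by lia.
  case=> [|i] i_n; first by [].
  by rewrite !nth_Peak_zeros 1?leNgt ?ltr_zero; lia.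
case=> [|i] i_n; first by rewrite nth_Peak_zeros ?ltW ?binomial_zero_lt0; lia.
by rewrite !nth_Peak_zeros 1?leNgt ?ltr_zero; nia.
Qed.

End Polynomials.

(** * Polynomials with prescribed real roots *)

Section RootProducts.

Variable R : realType.
Implicit Types (c : R) (s : seq R).

Lemma lead_coef_scale_prod_XsubC c s :
  lead_coef (c *: \prod_(z <- s) ('X - z%:P)) = c.
Proof. by rewrite lead_coefZ (monicP _) ?mulr1 // monic_prod_XsubC. Qed.

Lemma real_rooted_prod_XsubC c s :
  c != 0 -> real_rooted (c *: \prod_(z <- s) ('X - z%:P)).
Proof.
move=> c0; right=> z; rewrite map_polyZ rootZ ?fmorph_eq0 // rmorph_prod /=.
under eq_bigr do rewrite rmorphB /= map_polyX map_polyC /=.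
rewrite -(big_map (real_complex R) xpredT (fun w => 'X - w%:P)) root_prod_XsubC.
by case/mapP => x _ ->.
Qed.

Lemma mup_prod_XsubC s (x : R) :
  mup x (\prod_(z <- s) ('X - z%:P)) = count_mem x s.
Proof.
elim: s => [|z s IH]; first by rewrite big_nil mupNroot // root1.
rewrite big_cons mupM ?polyXsubC_eq0 ?(monic_neq0 (monic_prod_XsubC _ _ _)) //.
by rewrite IH -['X - _]expr1 mup_XsubCX /=; case: eqP.
Qed.

Lemma zero_seq_prod_XsubC c s : c != 0 -> sorted (fun x y => y <= x) s ->
  zero_seq (c *: \prod_(z <- s) ('X - z%:P)) s.
Proof.
move=> c0 s_sorted; split=> // x.
by rewrite -mul_polyC mupMr ?mup_prod_XsubC // rootC.
Qed.

End RootProducts.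

Theorem corollary4p10 (R : realType) :
  [/\ Peak R 1 = 'X,
      Peak R 2 = 'X + 'X^2,
      forall n : nat, (3 <= n)%N ->
        Peak R n = 2%:R *: Peak R (n - 1)%N + ('X - 1) * Peak R (n - 2)%N,
      forall n : nat, real_rooted (Peak R n)
    & generalized_sturm (Peak R)].
Proof.
have std n : std_real_rooted (Peak R n).
  have [c c0 ->] := Peak_factor R n; split; last by rewrite lead_coef_scale_prod_XsubC.
  exact/real_rooted_prod_XsubC/lt0r_neq0.
have zeros n : zero_seq (Peak R n) (Peak_zeros R n).
  have [c c0 ->] := Peak_factor R n; apply: zero_seq_prod_XsubC; first exact: lt0r_neq0.
  by apply: sub_sorted (Peak_zeros_sorted R n) => x y /ltW.
split.
- rewrite Peak_even_binomial // /even_binomial poly_def big_ord1 /= bin0 scale1r.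
  by rewrite expr0 mulr1.
- rewrite Peak_even_binomial // /even_binomial poly_def !big_ord_recl big_ord0 /=.
  by rewrite bin0 binn !scale1r addr0 expr0 mulrDr mulr1 expr1 expr2.
(* All three indices are positive here, so each [Peak] has the factor ['X]; [Peak R 0 = 1] lacks it,
   hence the bound 3. *)
- case=> [|[|[|n]]] // _; rewrite subSS subn0 !subSS subn0.
  by rewrite !Peak_even_binomial // even_binomialSS mulrDr -scalerAr mulrCA.
- by move=> n; case: (std n).
split=> // -[|n] // _; split; [by right|by right|move=> _ _].
by exists (Peak_zeros R n), (Peak_zeros R n.+1); split=> //; apply: Peak_zeros_interlaced.
Qed.
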